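(* For all integers $n\ge2$ and $1\le r\le n-1$, the entropy constant $\kappa(n,r)$ of the Bernoulli–Laplace model with $r$ particles satisfies $$\kappa(n,r)=\frac{r(n-r)\log 2}{\log\binom nr}.$$
   Context: Let $V$ be a set with $|V|=n$. Let $\Omega_{n,r}$ be the set of $\eta\in\{0,1\}^V$ with $\sum_{x\in V}\eta_x=r$, and let $\mu$ be the uniform distribution on its $\binom nr$ elements. For $f:\Omega_{n,r}\to[0,\infty)$ let $\mathrm{Ent} f=\mu[f\log(f/\mu(f))]$ (with $0\log0=0$), and for $x\ne y$ in $V$ let $\mathrm{Ent}_{xy}f=\mu_{xy}[f\log(f/\mu_{xy}f)]$, where $\mu_{xy}f=\frac12(f+f^{xy})$ and $f^{xy}(\eta)=f(\eta^{xy})$, with $\eta^{xy}$ the configuration obtained from $\eta$ by swapping the values $\eta_x$ and $\eta_y$. The constant $\kappa(n,r)$ is the largest $\kappa\ge0$ such that for all $f:\Omega_{n,r}\to[0,\infty)$, $$\kappa\,\mathrm{Ent} f\le\sum_{\{x,y\}\subset V,\ x\neq y}\mu[\mathrm{Ent}_{xy}f],$$ the sum being over unordered pairs. (Equivalently, $\kappa(n,r)$ is the best constant in $\kappa\,\mathrm{Ent} f\le\sum_{|A|=2}\mu[\mathrm{Ent}_A f]$ for the uniform measure on permutations, when restricted to functions $f(\sigma)=g(\xi_1,\dots,\xi_r)$ with $g$ symmetric, where $\xi_i$ is the position of label $i$.) *)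

(* Defs.v *)
From HB Require Import structures.
From mathcomp Require Import all_boot all_order all_fingroup all_algebra.
From mathcomp Require Import classical_sets reals exp.

Set Implicit Arguments.
Unset Strict Implicit.
Unset Printing Implicit Defensive.

Import Order.TTheory GRing.Theory Num.Theory.

Local Open Scope ring_scope.

Record config (V : finType) (r : nat) : Type := Config {
  occ :> {ffun V -> bool};
  _ : (\sum_(x : V) nat_of_bool (occ x))%N == r
}.

HB.instance Definition _ (V : finType) (r : nat) := [isSub for @occ V r].
HB.instance Definition _ (V : finType) (r : nat) :=
  [Equality of config V r by <:].
HB.instance Definition _ (V : finType) (r : nat) :=
  [Choice of config V r by <:].
HB.instance Definition _ (V : finType) (r : nat) :=
  [Countable of config V r by <:].
HB.instance Definition _ (V : finType) (r : nat) :=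
  [Finite of config V r by <:].

Lemma swap_subproof (V : finType) (r : nat) (x y : V) (eta : config V r) :
  (\sum_(z : V) nat_of_bool ([ffun z => eta (tperm x y z)] z))%N == r.
Proof.
rewrite (reindex_inj (@perm_inj _ (tperm x y))) -[X in _ == X](eqP (valP eta)).
by apply/eqP; apply: eq_bigr => z _; rewrite ffunE tpermK.
Qed.

Definition swap (V : finType) (r : nat) (x y : V) (eta : config V r) :
  config V r := Config (swap_subproof x y eta).

Section BernoulliLaplace.
Variables (R : realType) (V : finType) (r : nat).
Implicit Types (f : config V r -> R) (x y : V).

Definition mean f : R :=
  (#|{: config V r}|%:R)^-1 * \sum_(eta : config V r) f eta.

(* For [f >= 0], both [0 * log 0] and the case of a zero mean (where [f = 0])
   give [0], because the factor [f eta] vanishes. *)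
Definition Ent f : R := mean (fun eta => f eta * ln (f eta / mean f)).

Definition mean2 x y f : config V r -> R :=
  fun eta => 2^-1 * (f eta + f (swap x y eta)).

Definition Ent2 x y f : config V r -> R :=
  mean2 x y (fun eta => f eta * ln (f eta / mean2 x y f eta)).

Lemma swapC x y : @swap V r x y =1 swap y x.
Proof. by move=> eta; apply: val_inj; rewrite /= tpermC. Qed.

Lemma Ent2C x y f : Ent2 x y f =1 Ent2 y x f.
Proof. by move=> eta; rewrite /Ent2 /mean2 !(swapC x y). Qed.

(* Each unordered pair occurs twice among the ordered ones, with the same
   contribution by [Ent2C]. *)
Definition pair_entropy f : R :=
  2^-1 * \sum_(x : V) \sum_(y : V | x != y) mean (Ent2 x y f).

Definition entropy_admissible : set R :=
  [set k | 0 <= k /\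
     forall f, (forall eta, 0 <= f eta) -> k * Ent f <= pair_entropy f]%classic.

Definition is_entropy_constant (k : R) : Prop :=
  entropy_admissible k /\ ubound entropy_admissible k.

End BernoulliLaplace.

Arguments entropy_admissible {R} V r.
Arguments is_entropy_constant {R} V r k.

(* Main.v *)
Require Import Defs.
From mathcomp Require Import all_boot all_order all_algebra.
From mathcomp Require Import classical_sets reals exp.
From mathcomp Require Import boolp topology normedtype derive realfun.
From mathcomp Require Import all_fingroup fintype finset ring lra zify.

(* A Dirac mass shows that no larger constant is possible.  For the inequality,
   condition on the occupation of one site, average over the site and induct
   on the number of free sites: every step is an equality for Dirac masses, so
   it remains to bound the sum of the entropies of the one-site marginals by
   the pair entropies.  Write [s = k / m], [t = 1 - s] and let [X], [Y] be
   the densities of the one-site marginals at occupied and vacant sites.  By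
   Gibbs' inequality the contribution of a pair of configurations with values
   [x], [y] is at most [x ln x + y ln y - u ln u - v ln v], where
   [u = s x + t y] and [v = t x + s y].  With [H] the binary entropy in bits
   and [*] the convolution of biased bits, its comparison with the pair entropy
   is [1 - H (p * q) >= (1 - H p) (1 - H q)], i.e., the function
   [L a = (1 + a) ln (1 + a) + (1 - a) ln (1 - a)] satisfies
   [L a * L b <= L 1 * L (a b)]. *)

Import Order.TTheory GRing.Theory Num.Theory.
Import numFieldNormedType.Exports.

Set Implicit Arguments.
Unset Strict Implicit.
Unset Printing Implicit Defensive.

Local Open Scope ring_scope.

(** * Calculus of the binary entropy function *)

Section BinaryEntropy.
Variable R : realType.
Implicit Types a b x y z : R.

Lemma mean_value (f df : R -> R) a b :
  a < b -> (forall x, a <= x <= b -> is_derive x 1 f (df x)) ->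
  exists2 c, a < c < b & f b - f a = df c * (b - a).
Proof.
move=> ab fdf; have := @MVT R f df a b ab; case.
- by move=> x; rewrite in_itv /= => /andP[ax xb]; apply: fdf; rewrite !ltW.
- apply: derivable_within_continuous => x; rewrite in_itv /= => xab.
  by have [] := fdf x xab.
- by move=> c; rewrite in_itv /= => cab fE; exists c.
Qed.

(** The mean value theorem, used twice, turns [g a < 0] into a point [c] before [a] with [g' c < 0]
    and a point [d] before [c] with [g'' d < 0]. Beyond [d] the function is concave, so [g'] stays
    negative beyond [c] and [g] cannot recover after [a]. *)
Lemma convex_concave_decreasing (g g' g'' : R -> R) a z :
  (forall x, 0 <= x < 1 -> is_derive x 1 g (g' x)) ->
  (forall x, 0 <= x < 1 -> is_derive x 1 g' (g'' x)) ->
  (forall x y, 0 < x -> x < y -> y < 1 -> g'' x < 0 -> g'' y <= 0) ->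
  g 0 = 0 -> g' 0 = 0 -> 0 < a -> g a < 0 -> a < z -> z < 1 -> g z <= g a.
Proof.
move=> gd g'd g''_sign g0 g'0 a0 ga az z1.
have [x xa|c /andP[c0 ca]] := @mean_value g g' 0 a a0; first by apply: gd; lra.
rewrite g0 !subr0 => gaE.
have g'c : g' c < 0 by rewrite -(pmulr_llt0 _ a0) -gaE.
have [x xa|d /andP[d0 dc]] := @mean_value g' g'' 0 c c0; first by apply: g'd; lra.
rewrite g'0 !subr0 => g'cE.
have g''d : g'' d < 0 by rewrite -(pmulr_llt0 _ c0) -g'cE.
have [x xa|e /andP[ae ez] gzE] := @mean_value g g' a z az; first by apply: gd; lra.
have ce : c < e by lra.
have [x xa|h /andP[ch he] g'eE] := @mean_value g' g'' c e ce; first by apply: g'd; lra.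
have g''h : g'' h <= 0 by apply: (g''_sign d) => //; lra.
have : g' e - g' c <= 0 by rewrite g'eE mulr_le0_ge0 //; lra.
move=> g'ec; rewrite -subr_le0 gzE mulr_le0_ge0 //; lra.
Qed.

(** With [p = (1 + x) / 2] this is [2 ln 2 (1 - H p)], twice the relative entropy in nats of a bit
    of bias [x] with respect to a fair bit. *)
Definition bias_entropy x := (1 + x) * ln (1 + x) + (1 - x) * ln (1 - x).
Local Notation L := bias_entropy.

Let log_ratio x := ln (1 + x) - ln (1 - x).

Lemma is_derive_ln1D (c x : R) : 0 < 1 + c * x -> is_derive x 1 (fun y => ln (1 + c * y)) (c / (1 + c * x)).
Proof.
move=> h.
have -> : (fun y => ln (1 + c * y)) = (@ln R) \o (fun y => 1 + c * y) by [].
apply: is_derive_eq.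
  by apply: is_derive1_comp; apply: is_derive1_ln.
rewrite /GRing.scale /=. ring.
Qed.

Lemma is_derive_bias_entropy x b : 0 <= b * x < 1 ->
  is_derive x 1 (fun y => L (b * y)) (b * log_ratio (b * x)).
Proof.
move=> bx.
have -> : (fun y => L (b * y)) = (fun y => (1 + b * y) * ln (1 + b * y) + (1 + (- b) * y) * ln (1 + (- b) * y)).
  by apply/funext => y; rewrite /L mulNr.
have d1 := @is_derive_ln1D b x ltac:(lra).
have d2 := @is_derive_ln1D (-b) x ltac:(lra).
apply: is_derive_eq; rewrite /log_ratio /GRing.scale /= mulNr.
field.
by apply/andP; split; lra.
Qed.

Lemma is_derive_log_ratio x b : 0 <= b * x < 1 ->
  is_derive x 1 (fun y => log_ratio (b * y)) (b * (2 / (1 - (b * x) ^+ 2))).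
Proof.
move=> bx.
have -> : (fun y => log_ratio (b * y)) = (fun y => ln (1 + b * y) - ln (1 + (- b) * y)).
  by apply/funext => y; rewrite /log_ratio mulNr.
have d1 := @is_derive_ln1D b x ltac:(lra).
have d2 := @is_derive_ln1D (-b) x ltac:(lra).
apply: is_derive_eq; rewrite mulNr.
field.
apply/and3P; split; nra.
Qed.

Lemma bias_entropy_ge0 b : 0 <= b <= 1 -> 0 <= L b <= 2 * ln 2.
Proof.
move=> b1; apply/andP; split.
- have [->|bn1] := eqVneq b 1.
    rewrite /L subrr mul0r addr0 mulr_ge0 ?ln_ge0 //; lra.
  have b_lt1 : b < 1 by rewrite lt_neqAle bn1; lra.
  rewrite /L.
  (* These arguments make [ln (1 + u) <= u] give [(1 + b) ln (1 + b) >= b] and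
     [(1 - b) ln (1 - b) >= - b], whose sum is the claim. *)
  have := @le_ln1Dx R (- (b / (1 + b))); have := @le_ln1Dx R (b / (1 - b)).
  have -> : 1 + b / (1 - b) = (1 - b)^-1 by field; lra.
  have -> : 1 - b / (1 + b) = (1 + b)^-1 by field; lra.
  rewrite !lnV ?posrE; [|lra..].
  have p1 : 0 <= b / (1 - b) by rewrite divr_ge0 //; lra.
  have p2 : b / (1 + b) < 1 by rewrite ltr_pdivrMr; lra.
  move=> /(_ ltac:(lra)) h1 /(_ ltac:(lra)) h2.
  have h3 : - (1 - b) * ln (1 - b) <= b.
    have /(ler_wpM2l (_ : 0 <= 1 - b)) := h1.
    rewrite (_ : (1 - b) * (b / (1 - b)) = b); last by field; lra.
    by rewrite mulrN mulNr; apply; lra.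
  have h4 : b <= (1 + b) * ln (1 + b).
    rewrite -[leLHS](_ : (1 + b) * (b / (1 + b)) = b); last by field; lra.
    rewrite ler_wpM2l //; lra.
  lra.
- rewrite /L.
  have h1 : ln (1 + b) <= ln 2 by rewrite ler_ln ?posrE; lra.
  have h2 : ln (1 - b) <= 0 by apply: ln_le0; lra.
  have h3 : 0 <= ln (1 + b) by apply: ln_ge0; lra.
  nra.
Qed.

(** For fixed [b < 1] the difference [g] of the two sides, as a function of [a], vanishes to first
    order at 0 and tends to 0 at 1, while [g''] can change sign only from positive to negative. Were
    [g] negative at [a], it would stay below [g a] up to 1, against the limit. *)
Lemma bias_entropy_supermul a b : 0 <= a < 1 -> 0 <= b <= 1 ->
  L a * L b <= 2 * ln 2 * L (a * b).
Proof.
move=> a1 b1.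
have l2 : 0 < ln 2 :> R by apply: ln_gt0; lra.
have L0 : L 0 = 0 by rewrite /L subr0 addr0 ln1; ring.
have [->|an0] := eqVneq a 0; first by rewrite mul0r L0; lra.
have [->|bn1] := eqVneq b 1.
  have -> : L 1 = 2 * ln 2 by rewrite /L subrr; ring.
  by rewrite mulr1 mulrC.
have a0 : 0 < a by rewrite lt_neqAle eq_sym an0; lra.
have b_lt1 : b < 1 by rewrite lt_neqAle bn1; lra.
have /andP[Lb0 Lb2] := bias_entropy_ge0 b1.
(* The factor [1] lets the same derivative lemmas serve both terms. *)
pose g y := 2 * ln 2 * L (b * y) - L b * L (1 * y).
pose g' y := 2 * ln 2 * (b * log_ratio (b * y)) - L b * (1 * log_ratio (1 * y)).
pose g'' y := 2 * ln 2 * (b * (b * (2 / (1 - (b * y) ^+ 2)))) -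
  L b * (1 * (1 * (2 / (1 - (1 * y) ^+ 2)))).
rewrite -subr_ge0 leNgt; apply/negP => ga.
have gaE : g a = 2 * ln 2 * L (a * b) - L a * L b.
  by rewrite /g mul1r [b * a]mulrC [L b * _]mulrC.
have gd x : 0 <= x < 1 -> is_derive x 1 g (g' x).
  move=> x1; have d1 := @is_derive_bias_entropy x b ltac:(nra).
  have d2 := @is_derive_bias_entropy x 1 ltac:(lra).
  by apply: is_derive_eq; rewrite /GRing.scale /= /g'; ring.
have g'd x : 0 <= x < 1 -> is_derive x 1 g' (g'' x).
  move=> x1; have d1 := @is_derive_log_ratio x b ltac:(nra).
  have d2 := @is_derive_log_ratio x 1 ltac:(lra).
  by apply: is_derive_eq; rewrite /GRing.scale /= /g''; ring.
(* Once a positive factor is split off, what remains is nonincreasing in [x], because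
   [L b <= 2 ln 2]. *)
have g''E x : 0 < x < 1 -> g'' x =
    2 / (1 - (b * x) ^+ 2) / (1 - x ^+ 2) *
    (2 * ln 2 * b ^+ 2 - L b - (b * x) ^+ 2 * (2 * ln 2 - L b)).
  move=> x1; have bx : 0 <= b * x < 1 by nra.
  have ? : 0 < 1 - (b * x) ^+ 2 by nra.
  have ? : 0 < 1 - x ^+ 2 by nra.
  rewrite /g''; field; apply/andP; split; lra.
have pos x : 0 < x < 1 -> 0 < 2 / (1 - (b * x) ^+ 2) / (1 - x ^+ 2).
  move=> x1; have ? : 0 <= b * x < 1 by nra.
  by rewrite !divr_gt0 //; nra.
have g_sign x y : 0 < x -> x < y -> y < 1 -> g'' x < 0 -> g'' y <= 0.
  move=> x0 xy y1; have x01 : 0 < x < 1 by lra.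
  have y01 : 0 < y < 1 by lra.
  rewrite (g''E x) // (g''E y) // pmulr_rlt0 ?pos // pmulr_rle0 ?pos //.
  have : (b * x) ^+ 2 <= (b * y) ^+ 2 by rewrite !exprMn ler_wpM2l ?sqr_ge0 //; nra.
  have cL : 0 <= 2 * ln 2 - L b by lra.
  move=> /(ler_wpM2r cL); lra.
have g0 : g 0 = 0 by rewrite /g !mulr0 L0; ring.
have g'0 : g' 0 = 0 by rewrite /g' !mulr0 /log_ratio subr0 addr0 subrr; ring.
rewrite -gaE in ga.
have dec z := convex_concave_decreasing gd g'd g_sign g0 g'0 a0 ga (z := z).
pose C := log_ratio b.
(* A quantitative form of the limit at 1. The derivative of [L] blows up there, so [L z] is only
   bounded by [2 ln 2]; the mean value theorem is applied to [L (b * y)], which is smooth up to 1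
   since [b < 1]. *)
have gz z : a < z -> z < 1 -> - (2 * ln 2 * C * (1 - z)) <= g z.
  move=> az z1.
  have /andP[Lz0 Lz2] := @bias_entropy_ge0 z ltac:(lra).
  have [y yz|c /andP[zc c1] LE] := @mean_value (fun y => L (b * y)) (fun y => b * log_ratio (b * y)) z 1 z1.
    by apply: is_derive_bias_entropy; nra.
  rewrite mulr1 in LE.
  have rc : log_ratio (b * c) <= C.
    rewrite /C /log_ratio lerB // ler_ln ?posrE; nra.
  have : b * log_ratio (b * c) * (1 - z) <= C * (1 - z).
    rewrite ler_wpM2r //; first lra.
    have : 0 <= log_ratio (b * c).
      rewrite /log_ratio subr_ge0 ler_ln ?posrE; nra.
    nra.
  rewrite -LE /g mul1r; nra.
have C0 : 0 <= C by rewrite /C /log_ratio subr_ge0 ler_ln ?posrE; lra.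
pose D := 2 * ln 2 * C; have D0 : 0 <= D by rewrite /D !mulr_ge0 //; lra.
(* Chosen so that [a < 1 - e] and [D e < - g a]: at [1 - e] the two bounds on [g] contradict each
   other. *)
pose e := Num.min ((1 - a) / 2) (- g a / (2 * (1 + D))).
have e0 : 0 < e.
  by rewrite lt_min !divr_gt0 //; lra.
have ea : e <= (1 - a) / 2 by rewrite ge_min lexx.
have eD : e * (2 * (1 + D)) <= - g a.
  by rewrite -ler_pdivlMr ?ge_min ?lexx ?orbT //; lra.
have az : a < 1 - e by lra.
have := gz _ az ltac:(lra); have := dec _ az ltac:(lra).
rewrite -/D (_ : 1 - (1 - e) = e); [nra | ring].
Qed.

(** * Entropy inequalities for two values and their mixtures *)

Local Notation xlnx x := (x * ln x).

Lemma xlnxM x y : 0 <= x -> 0 <= y -> xlnx (x * y) = x * xlnx y + y * xlnx x.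
Proof.
rewrite !le_eqVlt => /predU1P[<-|x0] /predU1P[<-|y0]; rewrite ?(mul0r, mulr0, addr0) //.
rewrite lnM ?posrE //; ring.
Qed.

(** A sum over the two values, not a mean: it is twice the two-point entropy. *)
Definition pair_ent x y :=
  x * ln (x / (2^-1 * (x + y))) + y * ln (y / (2^-1 * (x + y))).

Lemma pair_entC x y : pair_ent x y = pair_ent y x.
Proof. by rewrite /pair_ent [y + x]addrC [LHS]addrC. Qed.

Lemma mul_ln_div x m : 0 <= x -> 0 < m -> x * ln (x / m) = xlnx x - x * ln m.
Proof.
rewrite le_eqVlt => /predU1P[<-|x0] m0; first by rewrite !mul0r subrr.
by rewrite ln_div ?posrE //; ring.
Qed.

Lemma pair_entE x y : 0 <= x -> 0 <= y -> 0 < x + y ->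
  pair_ent x y = xlnx x + xlnx y - (x + y) * ln (2^-1 * (x + y)).
Proof.
by move=> x0 y0 xy; rewrite /pair_ent !mul_ln_div //; try ring; lra.
Qed.

Lemma pair_ent0 : pair_ent 0 0 = 0.
Proof. by rewrite /pair_ent !mul0r addr0. Qed.

(** In the coordinates [x, y = c (1 ± b)] and [s, t = (1 ± a) / 2] the mixtures are [c (1 ± a b)].
    The terms in [ln c] cancel, and what is left is [c] times [L a * L b <= 2 ln 2 * L (a b)], up to
    a factor 2. *)
Lemma mixture_entropy_ordered (x y s t : R) : 0 <= y <= x -> 0 < t <= s -> s + t = 1 ->
  ln 2 * (xlnx x + xlnx y - xlnx (s * x + t * y) - xlnx (t * x + s * y)) <=
  (- xlnx s - xlnx t) * pair_ent x y.
Proof.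
move=> xy st st1.
have [xy0|xyn0] := eqVneq (x + y) 0.
  have [-> ->] : x = 0 /\ y = 0 by split; lra.
  by rewrite !mulr0 !addr0 mul0r pair_ent0 !subr0 mulr0 addr0 !mulr0.
have c0 : 0 < x + y by rewrite lt_neqAle eq_sym xyn0; lra.
pose c := (x + y) / 2; pose b := (x - y) / (x + y); pose a := s - t.
have c_gt0 : 0 < c by rewrite divr_gt0.
have b1 : 0 <= b <= 1.
  by rewrite divr_ge0 ?ler_pdivrMr ?mul1r; lra.
have a1 : 0 <= a < 1 by rewrite /a; lra.
have ab : 0 <= a * b <= 1 by nra.
have bE : b * (x + y) = x - y by rewrite /b mulfVK.
have xE : x = c * (1 + b) by rewrite /c; lra.
have yE : y = c * (1 - b) by rewrite /c; lra.
have sE : s = 2^-1 * (1 + a) by rewrite /a; lra.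
have tE : t = 2^-1 * (1 - a) by rewrite /a; lra.
have E1 : s * x + t * y = c * (1 + a * b) by rewrite xE yE sE tE; field.
have E2 : t * x + s * y = c * (1 - a * b) by rewrite xE yE sE tE; field.
have ln2V : ln (2^-1 : R) = - ln 2 by rewrite lnV // posrE; lra.
rewrite pair_entE; [|lra..].
rewrite E1 E2 (_ : 2^-1 * (x + y) = c); last by rewrite mulrC.
rewrite (_ : x + y = 2 * c); last by rewrite /c; field.
clearbody a b c; rewrite {}xE {}yE {}sE {}tE !xlnxM ?ln2V; [|lra..].
have /(ler_wpM2l (ltW c_gt0)) := bias_entropy_supermul a1 b1.
rewrite /L; lra.
Qed.

Lemma mixture_entropy (x y s t : R) : 0 <= x -> 0 <= y -> 0 < s -> 0 < t -> s + t = 1 ->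
  ln 2 * (xlnx x + xlnx y - xlnx (s * x + t * y) - xlnx (t * x + s * y)) <=
  (- xlnx s - xlnx t) * pair_ent x y.
Proof.
move=> x0 y0 s0 t0 st1.
have [xy|/ltW yx] := leP y x; have [ts|/ltW ts] := leP t s.
- by apply: mixture_entropy_ordered; rewrite ?xy ?ts ?y0 ?t0.
- have := @mixture_entropy_ordered x y t s; rewrite ?xy ?ts ?y0 ?s0 addrC.
  by move=> /(_ isT isT st1); lra.
- have := @mixture_entropy_ordered y x s t; rewrite ?yx ?ts ?x0 ?t0 pair_entC.
  rewrite [s * y + _]addrC [t * y + _]addrC.
  by move=> /(_ isT isT st1); lra.
- have := @mixture_entropy_ordered y x t s; rewrite ?yx ?ts ?x0 ?s0 addrC pair_entC.
  rewrite [s * y + _]addrC [t * y + _]addrC.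
  by move=> /(_ isT isT st1); lra.
Qed.

(** With [T = s x + t y], bounding [ln (Z T / z)] by [Z T / z - 1] in both terms and averaging
    leaves [T (s X + t Y) - T <= 0]. The total density is allowed to be less than 1 in order to
    cover a zero mass, where division by zero makes both densities 0. *)
Lemma gibbs (x y s t X Y : R) : 0 <= x -> 0 <= y -> 0 < s -> 0 < t ->
  0 <= X -> 0 <= Y -> (0 < x -> 0 < X) -> (0 < y -> 0 < Y) -> s * X + t * Y <= 1 ->
  s * (x * ln X) + t * (y * ln Y) <= s * xlnx x + t * xlnx y - xlnx (s * x + t * y).
Proof.
move=> x0 y0 s0 t0 X0 Y0 xX yY XY.
pose T := s * x + t * y; rewrite -/T.
have [T0|Tn0] := eqVneq T 0.
  have [-> ->] : x = 0 /\ y = 0 by split; rewrite /T in T0; nra.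
  by rewrite !mul0r !mulr0 addr0 T0 mul0r subr0.
have T_gt0 : 0 < T by rewrite lt_neqAle eq_sym Tn0 /T; nra.
have one z Z : 0 <= z -> 0 <= Z -> (0 < z -> 0 < Z) ->
    z * ln Z <= xlnx z - z * ln T + Z * T - z.
  rewrite le_eqVlt => /predU1P[<- Z0 _|z0 Z0 /(_ z0) Z_gt0].
    by rewrite !mul0r subrr add0r subr0 mulr_ge0 // ltW.
  have := @le_ln1Dx R (Z * T / z - 1).
  have p : 0 < Z * T / z by rewrite divr_gt0 // mulr_gt0.
  rewrite [1 + _]addrC subrK ln_div ?lnM ?posrE ?mulr_gt0 // => /(_ ltac:(lra)).
  move=> /(ler_wpM2l (ltW z0)).
  rewrite (_ : z * (Z * T / z - 1) = Z * T - z); last by field; lra.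
  lra.
have := ler_wpM2l (ltW s0) (one _ _ x0 X0 xX).
have := ler_wpM2l (ltW t0) (one _ _ y0 Y0 yY).
have : T * (s * X + t * Y) <= T by rewrite ler_piMr // ltW.
have : T * ln T = s * (x * ln T) + t * (y * ln T) by rewrite /T; ring.
have : T = s * x + t * y by [].
clearbody T; lra.
Qed.

(* The configuration-level form of the comparison between the entropy of a single site
   and the entropy of a pair: [(X, Y)] and [(X', Y')] are the densities of the one-site
   marginals at the two sites of the pair. *)
Lemma pair_ent_lower (x y s t X Y X' Y' : R) :
  0 <= x -> 0 <= y -> 0 < s -> 0 < t -> s + t = 1 ->
  0 <= X -> 0 <= Y -> 0 <= X' -> 0 <= Y' ->
  (0 < x -> 0 < X /\ 0 < Y') -> (0 < y -> 0 < X' /\ 0 < Y) ->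
  s * X + t * Y <= 1 -> s * X' + t * Y' <= 1 ->
  ln 2 * (x * (s * ln X + t * ln Y') + y * (s * ln X' + t * ln Y)) <=
  (- xlnx s - xlnx t) * pair_ent x y.
Proof.
move=> x0 y0 s0 t0 st X0 Y0 X'0 Y'0 xXY yXY XY XY'.
apply: le_trans (mixture_entropy x0 y0 s0 t0 st).
have l2 : 0 <= ln 2 :> R by apply: ln_ge0; lra.
rewrite ler_wpM2l //.
(* The four terms are regrouped by site instead of by configuration: each site contributes one
   mixture. *)
have := @gibbs x y s t X Y x0 y0 s0 t0 X0 Y0 (fun h => (xXY h).1) (fun h => (yXY h).2) XY.
have := @gibbs y x s t X' Y' y0 x0 s0 t0 X'0 Y'0 (fun h => (yXY h).1) (fun h => (xXY h).2) XY'.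
rewrite [s * y + _]addrC (_ : s = 1 - t); [lra|lra].
Qed.
End BinaryEntropy.

(** * Configurations conditioned on some of their sites *)

Section Slices.
Variables (V : finType) (r : nat).
Implicit Types (eta : config V r) (I J : {set V}) (x y z : V).

Definition occupied eta : {set V} := [set x | eta x].

(** Conditioning as a pair of sets: [I] collects the sites revealed as occupied, the complement of
    [J] those revealed as vacant, and [J :\: I] is free. *)
Definition slice I J : {set config V r} :=
  [set eta | (I \subset occupied eta) && (occupied eta \subset J)].

Lemma card_occupied eta : #|occupied eta| = r.
Proof.
rewrite -[RHS](eqP (valP eta)) -sum1_card big_mkcond /=.
by apply: eq_bigr => x _; rewrite inE; case: (eta x).
Qed.

Lemma occupied_inj : injective occupied.
Proof.
move=> eta eta' /setP h; apply: val_inj; apply/ffunP => x.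
by have := h x; rewrite !inE.
Qed.

Lemma occupied_exists (A : {set V}) : #|A| = r -> {eta | occupied eta = A}.
Proof.
move=> Ar; have h : (\sum_x nat_of_bool ([ffun x => x \in A] x))%N == r.
  rewrite -Ar -sum1_card [X in _ == X]big_mkcond /=.
  by apply/eqP; apply: eq_bigr => x _; rewrite ffunE; case: (x \in A).
by exists (Config h); apply/setP => x; rewrite inE /= ffunE.
Qed.

Lemma card_slice I J : I \subset J -> (#|I| <= r)%N ->
  #|slice I J| = 'C(#|J :\: I|, r - #|I|).
Proof.
move=> IJ Ir; rewrite -cards_draws -(card_in_imset (f := fun eta => occupied eta :\: I)).
  apply: eq_card => B; rewrite !inE; apply/imsetP/andP.
    case=> eta; rewrite inE => /andP[Ie eJ] ->; split; first exact: setSD.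
    by rewrite cardsD (setIidPr Ie) card_occupied.
  case=> BJ /eqP Bc.
  have IB : [disjoint I & B].
    by rewrite disjoint_sym; move: BJ; rewrite subsetD => /andP[].
  have [|eta eE] := @occupied_exists (I :|: B).
    by rewrite cardsU disjoint_setI0 // cards0 subn0 Bc subnKC.
  exists eta; rewrite ?inE eE.
    by rewrite subsetUl subUset IJ (subset_trans BJ) ?subsetDl.
  by rewrite setDUl setDv set0U; apply/esym/setDidPl; rewrite disjoint_sym.
move=> eta eta'; rewrite !inE => /andP[h _] /andP[h' _] hE; apply: occupied_inj.
by rewrite -(setID (occupied eta) I) -(setID (occupied eta') I) hE (setIidPr h) (setIidPr h').
Qed.

Lemma card_slice_occupied I J eta : eta \in slice I J ->
  #|[set x in J :\: I | eta x]| = (r - #|I|)%N.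
Proof.
rewrite inE => /andP[Ie eJ].
have <- : #|occupied eta :\: I| = (r - #|I|)%N by rewrite cardsD (setIidPr Ie) card_occupied.
apply: eq_card => x; rewrite !inE; case ex: (eta x); rewrite ?andbT ?andbF //.
by rewrite (subsetP eJ) ?andbT // inE.
Qed.

Lemma card_slice_vacant I J eta : eta \in slice I J ->
  #|[set x in J :\: I | ~~ eta x]| = (#|J :\: I| - (r - #|I|))%N.
Proof.
move=> eS; rewrite -(card_slice_occupied eS) -cardsDS; last first.
  by apply/subsetP => x; rewrite inE => /andP[].
by apply: eq_card => x; rewrite !inE; case: (eta x); rewrite ?andbT ?andbF ?andNb.
Qed.

Lemma slice_occupied I J x : slice (x |: I) J = [set eta in slice I J | eta x].
Proof. by apply/setP => eta; rewrite !inE subUset sub1set inE -andbA andbC. Qed.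

Lemma slice_vacant I J x : slice I (J :\ x) = [set eta in slice I J | ~~ eta x].
Proof.
apply/setP => eta; rewrite !inE subsetD1 inE; by rewrite andbA.
Qed.

Lemma swapK x y : involutive (@swap V r x y).
Proof. by move=> eta; apply: val_inj; apply/ffunP => z; rewrite /= !ffunE tpermK. Qed.

Lemma swapE x y eta z : swap x y eta z = eta (tperm x y z).
Proof. by rewrite /= ffunE. Qed.

Lemma slice_swap I J x y eta : x \in J :\: I -> y \in J :\: I ->
  (swap x y eta \in slice I J) = (eta \in slice I J).
Proof.
move=> xD yD.
suff h : forall eta, eta \in slice I J -> swap x y eta \in slice I J.
  by apply/idP/idP => /h //; rewrite swapK.
move=> {}eta; move: xD yD; rewrite !inE => /andP[xI xJ] /andP[yI yJ].
move=> /andP[/subsetP Ie /subsetP eJ]; apply/andP; split; apply/subsetP => z.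
  move=> zI; rewrite inE swapE tpermD; first by have := Ie _ zI; rewrite inE.
    by apply: contraNneq xI => ->.
  by apply: contraNneq yI => ->.
rewrite inE swapE; case: tpermP => [-> _|-> _|_ _ ez] //.
by apply: eJ; rewrite inE.
Qed.

(** * Sums over the moves of one particle to a vacant free site *)

Section Sums.
Variable R : realType.
Implicit Type f : config V r -> R.

Definition mass I J f : R := \sum_(eta in slice I J) f eta.

(* Unnormalised entropy; the conventions [ln 0 = 0] and [0 / 0 = 0] make it vanish
   when the mass does. *)
Definition slice_ent I J f : R :=
  \sum_(eta in slice I J) f eta * ln (f eta) - mass I J f * ln (mass I J f / #|slice I J|%:R).

Definition move_sum I J (F : config V r -> V -> V -> R) : R :=
  \sum_(eta in slice I J) \sum_(x in J :\: I | eta x) \sum_(y in J :\: I | ~~ eta y) F eta x y.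

(** Each pair of configurations related by a move is met twice, once from either end. *)
Definition dirichlet I J f : R :=
  move_sum I J (fun eta x y => pair_ent (f eta) (f (swap x y eta))).

Lemma move_sumE I J F : move_sum I J F =
  \sum_(x in J :\: I) \sum_(y in J :\: I) \sum_(eta in slice I J | eta x && ~~ eta y) F eta x y.
Proof.
rewrite /move_sum; under eq_bigr do rewrite big_mkcondr /=.
rewrite exchange_big /=; apply: eq_bigr => x _.
transitivity (\sum_(eta in slice I J) \sum_(y in J :\: I) if eta x && ~~ eta y then F eta x y else 0).
  apply: eq_bigr => eta _; rewrite big_mkcondr /=; case: (eta x) => //=.
  by rewrite big1.
rewrite exchange_big /=; apply: eq_bigr => y _; by rewrite [RHS]big_mkcondr.
Qed.

(** Reversing a move is a bijection on the moves inside a slice. *)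
Lemma move_sum_swap I J F :
  move_sum I J (fun eta x y => F (swap x y eta) y x) = move_sum I J F.
Proof.
rewrite !move_sumE [RHS]exchange_big /=.
apply: eq_bigr => x xD; apply: eq_bigr => y yD.
rewrite [RHS](reindex_inj (inv_inj (swapK x y))) /=.
by apply: eq_bigl => eta; rewrite slice_swap // !ffunE tpermL tpermR.
Qed.

Lemma move_sum_le I J F G :
  (forall eta x y, eta \in slice I J -> x \in J :\: I -> y \in J :\: I -> eta x -> ~~ eta y ->
     F eta x y <= G eta x y) -> move_sum I J F <= move_sum I J G.
Proof.
move=> FG; apply: ler_sum => eta eS; apply: ler_sum => x /andP[xD ex].
by apply: ler_sum => y /andP[yD ey]; apply: FG.
Qed.

Lemma move_sumZ I J F c : move_sum I J (fun eta x y => c * F eta x y) = c * move_sum I J F.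
Proof.
rewrite /move_sum mulr_sumr; apply: eq_bigr => eta _; rewrite mulr_sumr.
by apply: eq_bigr => x _; rewrite mulr_sumr.
Qed.

Lemma move_sumD I J F G :
  move_sum I J (fun eta x y => F eta x y + G eta x y) = move_sum I J F + move_sum I J G.
Proof.
rewrite /move_sum -big_split; apply: eq_bigr => eta _; rewrite -big_split.
by apply: eq_bigr => x _; rewrite -big_split.
Qed.

Lemma move_sum_exchange I J (A : {set V}) F :
  \sum_(z in A) move_sum I J (F z) = move_sum I J (fun eta x y => \sum_(z in A) F z eta x y).
Proof.
rewrite /move_sum exchange_big; apply: eq_bigr => eta _.
rewrite exchange_big; apply: eq_bigr => x _.
by rewrite exchange_big.
Qed.

(** An occupied [z] is never the target of a move, so removing it from the free sites only rules out
    the moves that start from it. *)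
Lemma move_sum_occupied I J z F : z \in J :\: I ->
  move_sum (z |: I) J F = move_sum I J (fun eta x y => (eta z && (z != x))%:R * F eta x y).
Proof.
move=> zD; rewrite /move_sum slice_occupied big_mkcond /= [RHS]big_mkcond /=.
apply: eq_bigr => eta _; rewrite inE; case: (eta \in slice I J) => //=.
case ez: (eta z) => /=; last first.
  by apply/esym; rewrite big1 // => x _; rewrite big1 // => y _; rewrite mul0r.
rewrite [LHS]big_mkcond [RHS]big_mkcond; apply: eq_bigr => x _ /=.
rewrite !inE [z == x]eq_sym; case: (eqVneq x z) => [->|xz] /=.
  by case: ifP => // _; rewrite big1 // => y _; rewrite mul0r.
case: ifP => // _; apply: eq_big => [y|y _]; last by rewrite mul1r.
by rewrite !inE; case: (eqVneq y z) => [->|_] //=; rewrite ez !andbF.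
Qed.

Lemma move_sum_vacant I J z F : z \in J :\: I ->
  move_sum I (J :\ z) F = move_sum I J (fun eta x y => (~~ eta z && (z != y))%:R * F eta x y).
Proof.
move=> zD; rewrite /move_sum slice_vacant big_mkcond /= [RHS]big_mkcond /=.
apply: eq_bigr => eta _; rewrite inE; case: (eta \in slice I J) => //=.
case ez: (eta z) => /=.
  by apply/esym; rewrite big1 // => x _; rewrite big1 // => y _; rewrite mul0r.
apply: eq_big => [x|x _].
  by rewrite !inE; case: (eqVneq x z) => [->|_] //=; rewrite ez !andbF.
rewrite [LHS]big_mkcond [RHS]big_mkcond; apply: eq_bigr => y _ /=.
rewrite !inE [z == y]eq_sym; case: (eqVneq y z) => [->|yz] /=.
  by rewrite andbF /= mul0r if_same.
by rewrite mul1r.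
Qed.

Lemma natr_sum_card (A : {set V}) (p : pred V) :
  \sum_(z in A) (p z)%:R = #|[set z in A | p z]|%:R :> R.
Proof.
rewrite -sum1_card natr_sum [RHS]big_mkcond [LHS]big_mkcond /=.
by apply: eq_bigr => z _; rewrite !inE; case: (z \in A); case: (p z).
Qed.

Lemma sumr_const_cond (A : {set V}) (p : pred V) (a : R) :
  \sum_(z in A | p z) a = #|[set z in A | p z]|%:R * a.
Proof.
by rewrite mulr_natl -sumr_const; apply: eq_bigl => z; rewrite inE.
Qed.

(* Averaging over the conditioned site: an occupied-vacant pair of [eta] survives the
   conditioning at any of the other sites. *)
Lemma sum_dirichlet I J f c d :
  I \subset J -> (#|I| < r < #|J|)%N ->
  \sum_(z in J :\: I) (c * dirichlet (z |: I) J f + d * dirichlet I (J :\ z) f) =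
  (c * (r - #|I| - 1)%:R + d * (#|J :\: I| - (r - #|I|) - 1)%:R) * dirichlet I J f.
Proof.
move=> IJ /andP[Ir rJ].
rewrite /dirichlet -move_sumZ.
under eq_bigr => z zD do rewrite move_sum_occupied // move_sum_vacant // -!move_sumZ -move_sumD.
rewrite move_sum_exchange /move_sum; apply: eq_bigr => eta eS.
apply: eq_bigr => x /andP[xD ex]; apply: eq_bigr => y /andP[yD ey].
under eq_bigr do rewrite !mulrA -mulrDl.
rewrite -mulr_suml big_split -!mulr_sumr !natr_sum_card; congr ((_ * _%:R + _ * _%:R) * _).
  have -> : [set z in J :\: I | eta z && (z != x)] = [set z in J :\: I | eta z] :\ x.
    by apply/setP => z; rewrite !inE; case: (z == x); rewrite ?andbF ?andbT.
  by rewrite -(card_slice_occupied eS) (cardsD1 x [set z in J :\: I | eta z]) inE xD ex add1n subn1.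
have -> : [set z in J :\: I | ~~ eta z && (z != y)] = [set z in J :\: I | ~~ eta z] :\ y.
  by apply/setP => z; rewrite !inE; case: (z == y); rewrite ?andbF ?andbT.
by rewrite -(card_slice_vacant eS) (cardsD1 y [set z in J :\: I | ~~ eta z]) inE yD ey add1n subn1.
Qed.

(** * Conditioning on one free site: chain rule and one-site marginals *)

Section Conditioning.
Variables (I J : {set V}) (f : config V r -> R).
Hypotheses (IJ : I \subset J) (Ir : (#|I| < r)%N) (rJ : (r < #|J|)%N).
Hypothesis f_ge0 : forall eta, 0 <= f eta.

Local Notation D := (J :\: I).
Local Notation m := #|D|.
Local Notation k := (r - #|I|)%N.
(** [s] and [t] are the probabilities that a given free site is occupied or vacant under the uniform
    law on the slice. *)
Let s : R := k%:R / m%:R.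
Let t : R := (m - k)%:R / m%:R.

Let k_gt0 : (0 < k)%N. Proof. by rewrite subn_gt0. Qed.

Let k_lt_m : (k < m)%N.
Proof. by rewrite cardsD (setIidPr IJ) ltn_sub2r // (ltn_trans Ir). Qed.

Let m_neq0 : m%:R != 0 :> R.
Proof. by rewrite pnatr_eq0 -lt0n (leq_ltn_trans _ k_lt_m). Qed.

Let s_gt0 : 0 < s.
Proof. by rewrite divr_gt0 // ltr0n // (leq_ltn_trans _ k_lt_m). Qed.

Let t_gt0 : 0 < t.
Proof. by rewrite divr_gt0 // ltr0n ?subn_gt0 // (leq_ltn_trans _ k_lt_m). Qed.

Let st1 : s + t = 1.
Proof. by rewrite /s /t -mulrDl -natrD subnKC 1?ltnW // divff. Qed.

Lemma card_slice_condition z : z \in D ->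
  (#|slice (z |: I) J|%:R = s * #|slice I J|%:R :> R) *
  (#|slice I (J :\ z)|%:R = t * #|slice I J|%:R :> R).
Proof.
move=> zD; move: (zD); rewrite inE => /andP[zI zJ].
have DI : J :\: (z |: I) = D :\ z.
  by apply/setP => x; rewrite !inE negb_or andbA.
have DJ : (J :\ z) :\: I = D :\ z.
  by apply/setP => x; rewrite !inE andbCA.
have mz : #|D :\ z| = m.-1 by rewrite (cardsD1 z D) zD.
have IJz : I \subset J :\ z by rewrite subsetD1 IJ.
have zIJ : z |: I \subset J by rewrite subUset sub1set zJ.
have cI : #|z |: I| = #|I|.+1 by rewrite cardsU1 zI.
rewrite !card_slice ?cI // 1?ltnW // DI DJ mz subnS.
have m_gt0 : (0 < m)%N by rewrite (leq_ltn_trans _ k_lt_m).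
have h1 := mul_bin_diag m k.-1; have h2 := mul_bin_down m k.
rewrite prednK // in h1.
split; rewrite /s /t mulrAC -natrM.
  by rewrite -h1 natrM mulrAC divff ?mul1r.
by rewrite -h2 natrM mulrAC divff ?mul1r.
Qed.

Let M := mass I J f.
Let P z := mass (z |: I) J f.
Let Q z := mass I (J :\ z) f.

Lemma slice_sum_condition z (g : config V r -> R) :
  \sum_(eta in slice I J) g eta =
  \sum_(eta in slice (z |: I) J) g eta + \sum_(eta in slice I (J :\ z)) g eta.
Proof.
rewrite slice_occupied slice_vacant (bigID (fun eta : config V r => eta z)) /=.
by congr (_ + _); apply: eq_bigl => eta; rewrite !inE.
Qed.

Let PQ z : P z + Q z = M.
Proof. by rewrite /P /Q /M /mass (slice_sum_condition z). Qed.

Let P_ge0 z : 0 <= P z. Proof. exact: sumr_ge0. Qed.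

Let Q_ge0 z : 0 <= Q z. Proof. exact: sumr_ge0. Qed.

(** For [M > 0], this is [M] times the relative entropy of the law of the occupation of [z] under
    [f] with respect to [(s, t)]. *)
Definition site_ent z : R := P z * ln (P z / (s * M)) + Q z * ln (Q z / (t * M)).

Let slice_gt0 : 0 < #|slice I J|%:R :> R.
Proof. by rewrite ltr0n card_slice ?bin_gt0 // ltnW. Qed.

(** The chain rule: the sums of [f ln f] split, and the normalising terms differ by [p ln (M / N)]
    for each of the two masses [p], which add up to [M ln (M / N)]. *)
Lemma slice_ent_condition z : z \in D ->
  slice_ent I J f = slice_ent (z |: I) J f + slice_ent I (J :\ z) f + site_ent z.
Proof.
move=> zD; rewrite /slice_ent (slice_sum_condition z) !card_slice_condition //.
rewrite -/M -/(P z) -/(Q z) /site_ent.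
set N := #|slice I J|%:R.
have h (p c : R) : 0 <= p <= M -> 0 < c ->
    p * ln (p / (c * N)) - p * ln (p / (c * M)) = p * ln (M / N).
  case/andP; rewrite le_eqVlt => /predU1P[<- _ _|p0 pM c0]; first by rewrite !mul0r subrr.
  have M0 : 0 < M by apply: lt_le_trans pM.
  by rewrite !ln_div ?lnM ?posrE ?mulr_gt0 //; ring.
have PM := PQ z.
have Pz := P_ge0 z; have Qz := Q_ge0 z.
have hP := h (P z) s ltac:(lra) s_gt0; have hQ := h (Q z) t ltac:(lra) t_gt0.
have : M * ln (M / N) = P z * ln (M / N) + Q z * ln (M / N) by rewrite -PM; ring.
lra.
Qed.

Let c : R := k%:R * (m - k)%:R / m%:R.

(** An occupied site starts [m - k] moves and a vacant one ends [k] moves. The weights [s] and [t]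
    on the two ends compensate for this, since [s (m - k) = t k = c], so every free site counts
    equally. *)
Lemma sum_site_ent (F G : V -> R) :
  move_sum I J (fun eta x y => f eta * (s * F x + t * G y)) =
  c * \sum_(z in D) (P z * F z + Q z * G z).
Proof.
transitivity (\sum_(eta in slice I J) f eta * (c * \sum_(z in D) if eta z then F z else G z)).
  apply: eq_bigr => eta eS.
  have -> : \sum_(z in D) (if eta z then F z else G z) =
      \sum_(z in D | eta z) F z + \sum_(z in D | ~~ eta z) G z.
    rewrite (bigID (fun z => eta z)) /=.
    by congr (_ + _); apply: eq_bigr => z /andP[_]; [move=> -> | move=> /negbTE ->].
  under eq_bigr do rewrite -mulr_sumr big_split /= sumr_const_cond (card_slice_vacant eS) -mulr_sumr.
  rewrite -mulr_sumr big_split /= sumr_const_cond (card_slice_occupied eS) -!mulr_sumr /s /t /c; ring.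
under eq_bigr do rewrite mulrCA mulr_sumr.
rewrite -mulr_sumr exchange_big /=; congr (_ * _); apply: eq_bigr => z zD.
rewrite /P /Q /mass !mulr_suml (slice_sum_condition z).
rewrite slice_occupied slice_vacant.
by congr (_ + _); apply: eq_bigr => eta; rewrite inE => /andP[_]; [move=> -> | move=> /negbTE ->].
Qed.

Lemma sum_site_ent_le :
  2 * ln 2 * c * \sum_(z in D) site_ent z <=
  (- (s * ln s) - t * ln t) * dirichlet I J f.
Proof.
pose X z := P z / (s * M); pose Y z := Q z / (t * M).
pose F eta x y := f eta * (s * ln (X x) + t * ln (Y y)).
(* Adding the reversed move doubles the sum and brings both configurations of a pair into one
   summand, as [pair_ent_lower] requires. *)
have -> : 2 * ln 2 * c * \sum_(z in D) site_ent z =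
    move_sum I J (fun eta x y => ln 2 * (F eta x y + F (swap x y eta) y x)).
  rewrite move_sumZ move_sumD (move_sum_swap I J F).
  by rewrite (sum_site_ent (fun x => ln (X x)) (fun x => ln (Y x))) /site_ent; ring.
rewrite /dirichlet -move_sumZ; apply: move_sum_le => eta x y eS xD yD ex ey.
have M_ge0 : 0 <= M by exact: sumr_ge0.
have X_ge0 z : 0 <= X z by rewrite divr_ge0 // mulr_ge0 // ltW.
have Y_ge0 z : 0 <= Y z by rewrite divr_ge0 // mulr_ge0 // ltW.
have XY z : s * X z + t * Y z <= 1.
  have [M0|Mn0] := eqVneq M 0.
    by rewrite /X /Y M0 !mulr0 invr0 !mulr0 addr0.
  suff -> : s * X z + t * Y z = 1 by [].
  transitivity ((P z + Q z) / M); last by rewrite PQ divff.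
  by rewrite /X /Y; field; rewrite Mn0 !gt_eqF.
(* A configuration of positive weight makes the marginals it contributes to positive, so the
   convention [ln 0 = 0] cannot spoil Gibbs' inequality. *)
have pos eta' x' y' : eta' \in slice I J -> eta' x' -> ~~ eta' y' -> 0 < f eta' ->
    0 < X x' /\ 0 < Y y'.
  move=> eS' ex' ey' fe.
  have Px : 0 < P x'.
    rewrite /P /mass (bigD1 eta') /=; last by rewrite slice_occupied inE eS'.
    by rewrite ltr_wpDr // sumr_ge0.
  have Qy : 0 < Q y'.
    rewrite /Q /mass (bigD1 eta') /=; last by rewrite slice_vacant inE eS'.
    by rewrite ltr_wpDr // sumr_ge0.
  have M0 : 0 < M by rewrite -(PQ x') ltr_wpDr.
  by rewrite /X /Y !divr_gt0 // mulr_gt0.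
rewrite /F.
apply: pair_ent_lower => //.
  exact: pos.
move=> h; apply: pos h; rewrite ?slice_swap // !ffunE ?tpermL ?tpermR //.
Qed.
End Conditioning.
End Sums.
End Slices.

(** * Induction on the number of free sites *)

Section Induction.
Variable R : realType.

Let ln2_gt0 : 0 < ln 2 :> R. Proof. by apply: ln_gt0; lra. Qed.

(* Half the inverse of the entropy constant, [dirichlet] running over ordered pairs; it is
   0 in the degenerate cases [k = 0] and [k = m] since 1 / 0 = 0. *)
Definition entropy_bound (m k : nat) : R :=
  ln 'C(m, k)%:R / (2 * k%:R * (m - k)%:R * ln 2).

(** The smaller binomial coefficients are [s 'C(m, k)] and [t 'C(m, k)], so their logarithms differ
    from [ln 'C(m, k)] by [ln s] and [ln t]; the coefficients [k] and [m - k] then recombine these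
    into the binary entropy. Equality here is what keeps the final constant sharp. *)
Lemma entropy_bound_rec (m k : nat) (s := k%:R / m%:R : R) (t := (m - k)%:R / m%:R : R) :
  (0 < k < m)%N ->
  m%:R * entropy_bound m k =
  (- (s * ln s) - t * ln t) / (2 * ln 2 * (k%:R * (m - k)%:R / m%:R)) +
  (entropy_bound m.-1 k.-1 * (k - 1)%:R + entropy_bound m.-1 k * (m - k - 1)%:R).
Proof.
case/andP=> k0 km.
have kR : 0 < k%:R :> R by rewrite ltr0n.
have mkR : 0 < (m - k)%:R :> R by rewrite ltr0n subn_gt0.
have mR : 0 < m%:R :> R by rewrite ltr0n (leq_ltn_trans _ km).
have CR : 0 < 'C(m, k)%:R :> R by rewrite ltr0n bin_gt0 ltnW.
have s0 : 0 < s by rewrite divr_gt0.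
have t0 : 0 < t by rewrite divr_gt0.
have E1 : entropy_bound m.-1 k.-1 * (k - 1)%:R =
    (ln s + ln 'C(m, k)%:R) / (2 * (m - k)%:R * ln 2).
  rewrite -lnM ?posrE // (_ : s * 'C(m, k)%:R = 'C(m.-1, k.-1)%:R); last first.
    rewrite /s mulrAC -natrM; have := mul_bin_diag m k.-1; rewrite prednK // => <-.
    by rewrite natrM mulrAC divff ?mul1r // gt_eqF.
  rewrite /entropy_bound subn1 (_ : m.-1 - k.-1 = m - k)%N; last by lia.
  (* The factor [k - 1] cancels only if it is nonzero; for [k = 1] the binomial coefficient is 1 and
     both sides vanish. *)
  case: k.-1 => [|j]; first by rewrite bin0 ln1 !mul0r.
  have : 0 < j.+1%:R :> R by rewrite ltr0n.
  by move: j.+1%:R => a a0; field; rewrite !gt_eqF.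
have E2 : entropy_bound m.-1 k * (m - k - 1)%:R =
    (ln t + ln 'C(m, k)%:R) / (2 * k%:R * ln 2).
  rewrite -lnM ?posrE // (_ : t * 'C(m, k)%:R = 'C(m.-1, k)%:R); last first.
    rewrite /t mulrAC -natrM -mul_bin_down.
    by rewrite natrM mulrAC divff ?mul1r // gt_eqF.
  rewrite /entropy_bound (_ : m.-1 - k = m - k - 1)%N; last by lia.
  case E : (m - k - 1)%N => [|j].
    by rewrite (_ : m.-1 = k) ?binn ?ln1 ?mul0r //; lia.
  have : 0 < j.+1%:R :> R by rewrite ltr0n.
  by move: j.+1%:R => a a0; field; rewrite !gt_eqF.
rewrite E1 E2 /entropy_bound.
have mE : m%:R = k%:R + (m - k)%:R :> R by rewrite -natrD subnKC // ltnW.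
have -> : m%:R * (ln 'C(m, k)%:R / (2 * k%:R * (m - k)%:R * ln 2)) =
  (k%:R + (m - k)%:R) * ln 'C(m, k)%:R / (2 * k%:R * (m - k)%:R * ln 2) :> R.
  by rewrite -mE mulrA.
rewrite [in - (s * _)]/s [in t * _]/t; field.
by rewrite !gt_eqF.
Qed.

Variables (V : finType) (r : nat).

Lemma slice_ent_le (f : config V r -> R) (I J : {set V}) :
  (forall eta, 0 <= f eta) -> I \subset J -> (#|I| <= r <= #|J|)%N ->
  slice_ent I J f <= entropy_bound #|J :\: I| (r - #|I|) * dirichlet I J f.
Proof.
move=> f0; move mE : #|J :\: I| => m.
elim: m I J mE => [|m IH] I J mE IJ /andP[Ir rJ].
all: have JE : #|J| = (#|I| + #|J :\: I|)%N by rewrite -(cardsID I J) (setIidPr IJ).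
(* A slice with a single configuration has no entropy, and its bound is 0; otherwise some free site
   is occupied and some free site is vacant. *)
all: have [N1|] := eqVneq 'C(#|J :\: I|, r - #|I|) 1%N.
1, 3: rewrite -mE /entropy_bound N1 ln1 !mul0r.
1, 2: have /cards1P[eta etaE] : #|slice r I J| == 1%N by rewrite card_slice ?N1.
1, 2: by rewrite /slice_ent /mass etaE !big_set1 cards1 divr1 subrr.
  by case/eqP; rewrite mE; have -> : (r - #|I|)%N = 0%N by lia.
move=> N1.
have Ir' : (#|I| < r)%N.
  by rewrite ltn_neqAle Ir andbT; apply: contraNneq N1 => ->; rewrite subnn bin0.
have rJ' : (r < #|J|)%N.
  by rewrite ltn_neqAle rJ andbT; apply: contraNneq N1 => ->; rewrite JE addKn binn.
rewrite -(ler_pM2l (_ : 0 < m.+1%:R)) ?ltr0n // mulrA entropy_bound_rec; last by lia.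
have -> : m.+1%:R * slice_ent I J f = \sum_(z in J :\: I)
   (slice_ent (z |: I) J f + slice_ent I (J :\ z) f + site_ent I J f z).
  rewrite -mE mulr_natl -sumr_const; apply: eq_bigr => z zD.
  exact: slice_ent_condition.
(* The binary entropy term of the recursion pays for the one-site entropies, the other two terms for
   the conditioned slices. *)
rewrite big_split mulrDl [leRHS]addrC lerD //; last first.
  have := sum_site_ent_le IJ Ir' rJ' f0; rewrite mE => h.
  rewrite mulrAC ler_pdivlMr; first by rewrite mulrC.
  by rewrite !mulr_gt0 ?invr_gt0 ?ltr0n // subn_gt0; lia.
have := sum_dirichlet f (entropy_bound m (r - #|I|).-1) (entropy_bound m (r - #|I|)) IJ.
rewrite Ir' rJ' mE => /(_ isT) <-.
apply: ler_sum => z; rewrite inE => /andP[zI zJ].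
have cI : #|z |: I| = #|I|.+1 by rewrite cardsU1 zI.
have cJ : #|J :\ z| = #|J|.-1 by rewrite (cardsD1 z J) zJ.
have zD : z \in J :\: I by rewrite inE zI.
have cD : #|(J :\: I) :\ z| = m by have := cardsD1 z (J :\: I); rewrite zD mE => -[].
apply: lerD.
  rewrite -subnS -cI; apply: IH; rewrite ?cI.
  - by rewrite -cD; apply: eq_card => x; rewrite !inE negb_or andbA.
  - by rewrite subUset sub1set zJ.
  - by rewrite Ir' ltnW.
apply: IH; rewrite ?cJ.
- by rewrite -cD; apply: eq_card => x; rewrite !inE andbCA.
- by rewrite subsetD1 IJ.
- by lia.
Qed.
End Induction.

(** * Translation to the normalised entropies on all configurations *)

Section EntropyConstant.
Variables (R : realType) (V : finType) (r : nat).
Implicit Type f : config V r -> R.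
Local Notation N := (#|{: config V r}|%:R : R).

Lemma slice_full : slice r set0 [set: V] = [set: config V r].
Proof. by apply/setP => eta; rewrite !inE sub0set subsetT. Qed.

Lemma card_config : #|{: config V r}| = 'C(#|V|, r).
Proof.
rewrite -[LHS]cardsT -slice_full card_slice ?sub0set ?cards0 ?subn0 ?setD0 ?cardsT //.
Qed.

Let half_double (a : R) : 2^-1 * (a + a) = a.
Proof. by field. Qed.

Lemma sum_slice_full (g : config V r -> R) :
  \sum_(eta in slice r set0 [set: V]) g eta = \sum_eta g eta.
Proof. by rewrite slice_full; apply: eq_bigl => eta; rewrite inE. Qed.

Lemma Ent_slice f : (forall eta, 0 <= f eta) -> Ent f = N^-1 * slice_ent set0 [set: V] f.
Proof.
move=> f0; rewrite /Ent /slice_ent /mass /mean !sum_slice_full slice_full cardsT; congr (_ * _).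
have M0 : 0 <= \sum_eta f eta by apply: sumr_ge0.
have [Mz|Mn0] := eqVneq (\sum_eta f eta) 0.
  have fz eta : f eta = 0.
    by apply/eqP; move: Mz => /eqP; rewrite psumr_eq0 // => /allP; apply; rewrite ?mem_index_enum.
  rewrite Mz mul0r subr0; apply: eq_bigr => eta _; by rewrite fz !mul0r.
have M_gt0 : 0 < \sum_eta f eta by rewrite lt_neqAle eq_sym Mn0.
have N_gt0 : 0 < N.
  rewrite ltr0n; apply/card_gt0P.
  have /existsP[eta _] : [exists eta, f eta != 0].
    apply: contraNT Mn0 => /existsPn h; rewrite big1 // => eta _.
    by apply/eqP; move: (h eta); rewrite negbK.
  by exists eta.
rewrite [in RHS]mulr_suml -sumrB; apply: eq_bigr => eta _.
by rewrite mul_ln_div ?mulr_gt0 ?invr_gt0 // [_ / N]mulrC.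
Qed.

Lemma swap_id x y (eta : config V r) : eta x = eta y -> swap x y eta = eta.
Proof.
move=> exy; apply: val_inj; apply/ffunP => z; rewrite /= ffunE.
by case: tpermP => [->|->|].
Qed.

(** The outer average over the swap does not change a sum over all configurations. Configurations
    fixed by the swap contribute 0, and the others are grouped with their images. *)
Lemma sum_Ent2 f x y : (forall eta, 0 <= f eta) ->
  \sum_eta Ent2 x y f eta =
  \sum_(eta : config V r | eta x && ~~ eta y) pair_ent (f eta) (f (swap x y eta)).
Proof.
move=> f0.
have swap_sum (p : pred (config V r)) (g : config V r -> R) :
    \sum_(eta | p eta) g (swap x y eta) = \sum_(eta | p (swap x y eta)) g eta.
  rewrite (reindex_inj (inv_inj (@swapK V r x y))) /=.
  by apply: eq_bigr => eta _; rewrite swapK.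
pose G eta := f eta * ln (f eta / mean2 x y f eta).
have -> : \sum_eta Ent2 x y f eta = \sum_eta G eta.
  transitivity (\sum_eta 2^-1 * (G eta + G (swap x y eta))); first exact: eq_bigr.
  by rewrite -mulr_sumr big_split /= (swap_sum xpredT G) half_double.
rewrite (bigID (fun eta : config V r => eta x == eta y)) /= big1 ?add0r; last first.
  move=> eta /eqP exy; rewrite /G /mean2 swap_id // half_double.
  have [->|fn0] := eqVneq (f eta) 0; first by rewrite mul0r.
  by rewrite divff // ln1 mulr0.
rewrite (bigID (fun eta : config V r => eta x)) /=.
have -> : \sum_(eta : config V r | (eta x != eta y) && ~~ eta x) G eta =
    \sum_(eta : config V r | eta x && ~~ eta y) G (swap x y eta).
  rewrite swap_sum; apply: eq_bigl => eta; rewrite !ffunE tpermL tpermR.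
  by case: (eta x); case: (eta y).
rewrite (eq_bigl (fun eta : config V r => eta x && ~~ eta y)); last first.
  by move=> eta; case: (eta x); case: (eta y).
rewrite -big_split; apply: eq_bigr => eta _.
by rewrite /G /mean2 swapK /pair_ent [f (swap _ _ _) + f eta]addrC.
Qed.

Lemma pair_entropy_dirichlet f : (forall eta, 0 <= f eta) ->
  pair_entropy f = 2^-1 * (N^-1 * dirichlet set0 [set: V] f).
Proof.
move=> f0; rewrite /pair_entropy; congr (_ * _).
rewrite /dirichlet move_sumE mulr_sumr [RHS](eq_bigl xpredT); last by move=> x; rewrite !inE.
apply: eq_bigr => x _; rewrite mulr_sumr [LHS]big_mkcond [RHS]big_mkcond /=.
apply: eq_bigr => y _; rewrite !inE /= /mean sum_Ent2 //.
rewrite [X in _ = _ * X](eq_bigl (fun eta : config V r => eta x && ~~ eta y)); last first.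
  by move=> eta; rewrite !inE sub0set subsetT.
case: (eqVneq x y) => [->|//]; rewrite big_pred0 ?mulr0 // => eta.
by rewrite andbN.
Qed.

(** * Dirac masses, the extremal functions *)

Section Dirac.
Variable eta0 : config V r.

Let delta eta : R := (eta == eta0)%:R.

Lemma Ent_delta : Ent delta = N^-1 * ln N.
Proof.
rewrite Ent_slice => [|eta]; last exact: ler0n.
rewrite /slice_ent /mass !sum_slice_full slice_full cardsT; congr (_ * _).
have -> : \sum_eta delta eta = 1.
  by rewrite (bigD1 eta0) //= /delta eqxx big1 ?addr0 // => eta /negbTE ->.
rewrite big1 => [|eta _]; last by rewrite /delta; case: eqP => _; rewrite ?ln1 ?mulr0 ?mul0r.
by rewrite mul1r div1r lnV ?sub0r ?opprK // posrE ltr0n; apply/card_gt0P; exists eta0.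
Qed.

(** Only moves with an end at [eta0] contribute, each the value [pair_ent 1 0 = ln 2], and
    [r (#|V| - r)] moves start there. *)
Lemma pair_entropy_delta : pair_entropy delta = N^-1 * (r%:R * (#|V| - r)%:R * ln 2).
Proof.
rewrite pair_entropy_dirichlet => [|eta]; last exact: ler0n.
rewrite mulrCA; congr (_ * _).
(* [F] sees the moves out of [eta0]; its reversal sees those into [eta0]. *)
pose F eta (x y : V) : R := delta eta * ln 2.
have -> : dirichlet set0 [set: V] delta =
    move_sum set0 [set: V] (fun eta x y => F eta x y + F (swap x y eta) y x).
  rewrite /dirichlet !move_sumE; apply: eq_bigr => x _; apply: eq_bigr => y _.
  apply: eq_bigr => eta /andP[_ /andP[ex ey]].
  have ne : swap x y eta != eta.
    by apply: contraNneq ey => /(congr1 (fun e : config V r => e y)); rewrite swapE tpermR => <-.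
  rewrite /F /delta /pair_ent.
  have [e1|n1] := eqVneq eta eta0; have [e2|n2] := eqVneq (swap x y eta) eta0.
  - by rewrite e2 e1 eqxx in ne.
  - by rewrite addr0 mulr1 invrK !mul0r !mul1r.
  - by rewrite add0r mulr1 invrK !mul0r !mul1r.
  - by rewrite !mul0r.
rewrite move_sumD (move_sum_swap set0 [set: V] F) half_double.
rewrite /move_sum sum_slice_full (bigD1 eta0) //= [X in _ + X]big1 ?addr0; last first.
  move=> eta /negbTE ne; rewrite big1 // => x _; rewrite big1 // => y _.
  by rewrite /F /delta ne mul0r.
have eS : eta0 \in slice r set0 [set: V] by rewrite slice_full inE.
rewrite (eq_bigr (fun=> (#|V| - r)%:R * ln 2)) => [|x _].
  by rewrite sumr_const_cond (card_slice_occupied eS) cards0 subn0 mulrA.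
by rewrite /F /delta eqxx mul1r sumr_const_cond (card_slice_vacant eS) cards0 subn0 setD0 cardsT.
Qed.
End Dirac.

End EntropyConstant.

Theorem theorem1p12 (R : realType) (n r : nat) (V : finType)
    (hV : #|V| = n) (hn : (2 <= n)%N) (hr : (1 <= r <= n - 1)%N) (kappa : R) :
  is_entropy_constant V r kappa <->
  kappa = r%:R * (n - r)%:R * ln 2 / ln ('C(n, r)%:R).
Proof.
set k := _ / _.
have rn : (r < n)%N by lia.
have C_gt1 : (1 < 'C(n, r))%N.
  (* Pascal's rule splits the coefficient into two terms, both positive as [0 < r < n]. *)
  have := bin_gt0 n r; have := bin1 n; have := @binS (n.-1) r.-1.
  have := bin_gt0 n.-1 r.-1; have := bin_gt0 n.-1 r; rewrite !prednK; lia.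
have lnC : 0 < ln 'C(n, r)%:R :> R by rewrite ln_gt0 // ltr1n.
have ln2 : 0 < ln 2 :> R by apply: ln_gt0; rewrite ltr1n.
have r0 : 0 < r%:R :> R by rewrite ltr0n; lia.
have nr0 : 0 < (n - r)%:R :> R by rewrite ltr0n; lia.
have card_config : #|{: config V r}| = 'C(n, r) by rewrite card_config hV.
have k_adm : entropy_admissible V r k.
  split=> [|f f0]; first by rewrite /k divr_ge0 ?mulr_ge0 // ltW.
  have := @slice_ent_le R V r f set0 [set: V] f0 (sub0set _).
  rewrite cards0 cardsT setD0 hV subn0 => /(_ ltac:(lia)) h.
  rewrite Ent_slice // pair_entropy_dirichlet // card_config.
  rewrite mulrCA [leRHS]mulrCA ler_wpM2l ?invr_ge0 //.
  rewrite cardsT hV in h.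
  have kE : k * entropy_bound R n r = 2^-1.
    by rewrite /k /entropy_bound; field; rewrite !gt_eqF.
  by rewrite -kE -[leRHS]mulrA ler_wpM2l // /k divr_ge0 ?mulr_ge0 // ltW.
have k_ub : ubound (entropy_admissible V r) k.
  move=> c [c0 cle].
  have /card_gt0P[eta0 _] : (0 < #|{: config V r}|)%N by rewrite card_config; lia.
  have := cle (fun eta => (eta == eta0)%:R) (fun _ => ler0n _ _).
  rewrite Ent_delta pair_entropy_delta card_config hV mulrCA ler_pM2l.
    by rewrite -ler_pdivlMr.
  by rewrite invr_gt0 ltr0n; lia.
split=> [[adm ub]|->]; last by split.
by apply/le_anti/andP; split; [exact: k_ub | exact: ub].
Qed.
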